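(* For all integers $n\ge 1$ and $s\ge 1$, the polynomials $Q_n^s(x)=x^nL_n^s(x)$ satisfy the recurrence relation $$Q_{n+1}^s(x)=x^2Q_n^s(x)+xA_n^s(x),$$ where the polynomials $A_n^s(x)$ are defined for $n\ge 1$, $s\ge 1$ by $$A_n^s(x)=\sum_{k=0}^n(n+k)^s\left\lfloor\!\!\left\lfloor\begin{matrix} n\\ k\end{matrix}\right\rfloor\!\!\right\rfloor_{s}x^{n+k}.$$
   Context: $[n]=\{1,2,\dots,n\}$ (with $[0]=\emptyset$). A partition of $[n]$ into $k$ lists is a set partition of $[n]$ into $k$ non-empty blocks, each block equipped with a linear order. For a partition $\pi=\{b_1,\dots,b_k\}$ the set of block leaders is $\operatorname{bl}\pi=\{\min b_1,\dots,\min b_k\}$ (minima with respect to the usual order of integers). The Lah number with higher level (level $s$), $\left\lfloor\!\!\left\lfloor\begin{matrix} n\\ k\end{matrix}\right\rfloor\!\!\right\rfloor_{s}$, is the number of ordered $s$-tuples $(\pi_1,\dots,\pi_s)$ of partitions of $[n]$ into $k$ lists such that $\operatorname{bl}\pi_1=\dots=\operatorname{bl}\pi_s$. For $n\ge1$, $s\ge1$: $L_n^s(x)=\sum_{k=0}^n\left\lfloor\!\!\left\lfloor\begin{matrix} n\\ k\end{matrix}\right\rfloor\!\!\right\rfloor_{s}x^k$. *)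

(* Defs.v *)
From mathcomp Require Import all_boot all_order all_algebra.

Set Implicit Arguments.
Unset Strict Implicit.
Unset Printing Implicit Defensive.

Import GRing.Theory.

(* The ground set [n] = {1, ..., n} is represented by 'I_n, shifted by one.
   A block equipped with a linear order is a duplicate-free sequence over
   'I_n; such a sequence has size at most n, hence the finite type
   n.-bseq 'I_n. *)
Definition block (n : nat) (l : n.-bseq 'I_n) : {set 'I_n} := [set x in l].

(* The blocks are non-empty because [partition] excludes set0; the cardinality
   condition rules out the same block occurring under two different orders. *)
Definition list_partition (n : nat) (k : nat) (p : {set n.-bseq 'I_n}) : bool :=
  let blocks := [set block l | l in p] in
  [&& #|p| == k,
      [forall l in p, uniq l],
      #|blocks| == #|p|
    & partition blocks [set: 'I_n]].

Definition leaders (n : nat) (p : {set n.-bseq 'I_n}) : {set 'I_n} :=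
  [set i | [exists l in p, (i \in block l) && [forall j in block l, i <= j]]].

Definition lah (s n k : nat) : nat :=
  #|[set t : s.-tuple {set n.-bseq 'I_n} |
      [forall i, list_partition k (tnth t i)]
      && [forall i, forall j, leaders (tnth t i) == leaders (tnth t j)]]|.

Local Open Scope ring_scope.

Definition L_poly (s n : nat) : {poly int} :=
  \sum_(k < n.+1) (lah s n k)%:R *: 'X^k.

Definition Q_poly (s n : nat) : {poly int} := 'X^n * L_poly s n.

Definition A_poly (s n : nat) : {poly int} :=
  \sum_(k < n.+1) ((n + k) ^ s * lah s n k)%:R *: 'X^(n + k).

(* Main.v *)
Require Import Defs.
From mathcomp Require Import all_boot all_order all_algebra.

Set Implicit Arguments.
Unset Strict Implicit.
Unset Printing Implicit Defensive.

Import GRing.Theory.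

(** Comparing coefficients, the theorem says that
      lah s (n+1) k = lah s n (k-1) + (n+k)^s lah s n k.

    Let w(B) be the number of list partitions of an n-element set whose set of
    leaders is B. A list partition has as many lists as leaders, and an s-tuple
    with common leader set B is any choice of s list partitions counted by
    w(B), so lah s n k is the sum of w(B)^s over the sets B with k elements
    ([lah_leader_count]). It is therefore enough to understand how w changes
    when a new largest element m is added, for each B separately; the exponent
    s then takes care of itself.

    Deleting m from a list partition of the larger set leaves a list partition
    p of the smaller one; conversely m is put back either as a list of its own,
    or somewhere in a list of p. Both cases are treated as one by regarding the
    former as the insertion of m into an empty list adjoined to p: list
    partitions of the larger set correspond bijectively to triples (p, l, i)
    with l either empty or in p, and i a position at most the size of l
    ([add_max_inj], [add_max_imset]). As m is larger than everything else, it
    becomes a leader exactly when l is empty, and it never displaces another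
    leader ([leaders_add_max]). Hence
    - w(B + m) = w(B), the list m being alone ([leader_count_max]);
    - w(B) is multiplied by the sum over the lists l of (size l + 1), which is
      n + #|B|, when m is not a leader ([leader_count_nomax]).
    Splitting the subsets of the larger set according to whether they contain m
    gives the two terms of the recurrence ([lahS]). *)

(** * Partitions into lists *)

Lemma bseq_has_mem (T : eqType) n (l : n.-bseq T) :
  l != [bseq] -> exists x, x \in l.
Proof.
case: l => [[|x l] sz] ne; last by exists x; rewrite inE eqxx.
by case/eqP: ne; apply: val_inj.
Qed.

Definition list_partitions n : {set {set n.-bseq 'I_n}} :=
  [set p : {set n.-bseq 'I_n} | list_partition #|p| p].

(** Unlike [partition], this description involves the lists only through their
    elements, so that it is easy to follow when one element is added. *)
Lemma list_partitionsP n (p : {set n.-bseq 'I_n}) :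
  reflect
    [/\ {in p, forall l : n.-bseq 'I_n, uniq l}, [bseq] \notin p,
        forall x : 'I_n, exists2 l, l \in p & x \in l
      & {in p &, forall l1 l2 (x : 'I_n), x \in l1 -> x \in l2 -> l1 = l2}]
    (p \in list_partitions n).
Proof.
rewrite inE /list_partition eqxx /=; apply: (iffP and3P).
- case=> /forall_inP unip /imset_injP injp.
  case/and3P=> /eqP covp /trivIsetP trivp p0.
  split=> //.
  + apply: contra p0 => p_nil; apply/imsetP; exists [bseq]; first by [].
    by apply/setP=> x; rewrite !inE.
  + move=> x; have: x \in cover [set block l | l in p] by rewrite covp inE.
    case/bigcupP=> _ /imsetP[l lp ->]; rewrite inE => xl.
    by exists l.
  + move=> l1 l2 l1p l2p x xl1 xl2; apply: injp => //; apply/eqP.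
    apply: contraTT isT => /(trivp _ _ (imset_f _ l1p) (imset_f _ l2p)).
    by move/pred0P/(_ x); rewrite /= !inE xl1 xl2.
- case=> unip p_nil covp trivp.
  have memE (l : n.-bseq 'I_n) x : (x \in block l) = (x \in l) by rewrite inE.
  have ne l : l \in p -> exists x, x \in l.
    by move=> lp; apply: bseq_has_mem; apply: contraNneq p_nil => <-.
  split.
  + exact/forall_inP.
  + apply/imset_injP=> l1 l2 l1p l2p /setP eq_l.
    have [x xl1] := ne _ l1p; apply: (trivp _ _ l1p l2p x) => //.
    by rewrite -memE -eq_l memE.
  + apply/and3P; split.
    * apply/eqP/setP=> x; rewrite inE; apply/bigcupP.
      have [l lp xl] := covp x; exists (block l); last by rewrite memE.
      exact: imset_f.
    * apply/trivIsetP=> _ _ /imsetP[l1 l1p ->] /imsetP[l2 l2p ->].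
      apply: contraR => /pred0Pn[x /andP[/=]]; rewrite !memE => xl1 xl2.
      by rewrite (trivp _ _ l1p l2p x).
    * apply/imsetP=> -[l /ne[x xl] /setP/(_ x)].
      by rewrite memE xl inE.
Qed.

Lemma leadersP n (p : {set n.-bseq 'I_n}) (i : 'I_n) :
  reflect (exists l : n.-bseq 'I_n,
             [/\ l \in p, i \in l & {in l, forall j : 'I_n, i <= j}])
          (i \in leaders p).
Proof.
rewrite inE; apply: (iffP exists_inP) => [[l lp] | [l [lp il min_i]]].
  rewrite inE => /andP[il /forall_inP min_i].
  by exists l; split=> // j jl; apply: min_i; rewrite inE.
exists l => //; rewrite inE il; apply/forall_inP=> j; rewrite inE.
exact: min_i.
Qed.

(** Sending a leader to its list is a bijection onto the lists: this is why the
    number [k] of lists is determined by the set of leaders. *)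
Lemma card_leaders n (p : {set n.-bseq 'I_n}) :
  p \in list_partitions n -> #|leaders p| = #|p|.
Proof.
case/list_partitionsP=> unip p_nil covp trivp.
pose list_of (x : 'I_n) : n.-bseq 'I_n :=
  odflt [bseq] [pick l : n.-bseq 'I_n | (l \in p) && (x \in l)].
have list_ofE (x : 'I_n) l : l \in p -> x \in l -> list_of x = l.
  move=> lp xl; rewrite /list_of; case: pickP => [l' /andP[l'p xl']|/(_ l)] /=.
    exact: (trivp _ _ l'p lp x).
  by rewrite lp xl.
rewrite -(card_in_imset (f := list_of)); last first.
  move=> x y /leadersP[l [lp xl min_x]] /leadersP[l' [l'p yl' min_y]].
  rewrite (list_ofE _ _ lp xl) (list_ofE _ _ l'p yl') => eq_l.
  apply/val_inj/eqP; rewrite /= eqn_leq min_x ?eq_l //.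
  by rewrite min_y // -eq_l.
congr #|pred_of_set _|; apply/setP=> l; apply/imsetP/idP=> [[x]|lp].
  by case/leadersP=> l' [l'p xl' _] ->; rewrite (list_ofE _ _ l'p xl').
have [x xl] : exists x, x \in l.
  by apply: bseq_has_mem; apply: contraNneq p_nil => <-.
case: (arg_minnP (P := fun y => y \in l) (@nat_of_ord n) xl) => y yl min_y.
by exists y; [apply/leadersP; exists l | rewrite (list_ofE _ _ lp)].
Qed.

Lemma sum_size_lists n (p : {set n.-bseq 'I_n}) :
  p \in list_partitions n -> \sum_(l in p) size l = n.
Proof.
case/list_partitionsP=> unip p_nil covp trivp.
rewrite -[RHS]card_ord -sum1_card.
transitivity (\sum_(l in p) \sum_(x : 'I_n) (x \in l : nat)).
  apply: eq_bigr => l lp; rewrite -(card_uniqP (unip _ lp)) -sum1_card.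
  rewrite big_mkcond.
  by apply: eq_bigr => x _; case: (x \in l).
rewrite exchange_big; apply: eq_bigr => x _ /=.
have [l lp xl] := covp x; rewrite (bigD1 l) //= xl big1 ?addn0 //.
move=> l' /andP[l'p]; case xl': (x \in l') => // /eqP[].
exact: (trivp _ _ l'p lp x).
Qed.

(** * Inserting the largest element *)

(** The ground set 'I_n is embedded into 'I_n.+1 by [lift ord_max], which keeps
    the value of each element; [ord_max] is then the new largest element. *)
Definition raise n (l : n.-bseq 'I_n) : n.+1.-bseq 'I_n.+1 :=
  insub_bseq n.+1 [seq lift ord_max x | x <- l].

Definition insert_max n (l : n.-bseq 'I_n) (i : nat) : n.+1.-bseq 'I_n.+1 :=
  insub_bseq n.+1
    (take i (raise l) ++ ord_max :: drop i (raise l)).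

Definition remove_max n (l : n.+1.-bseq 'I_n.+1) : n.-bseq 'I_n :=
  insub_bseq n (pmap (unlift ord_max) l).

(** For the triple [(p, l, i)], the list [l] of [p] is replaced by the result of
    inserting the new element. When [l] is the empty list, [p :\ l] is [p] and
    the new element forms a list by itself. *)
Definition add_max n (t : {set n.-bseq 'I_n} * n.-bseq 'I_n * 'I_n.+1) :
    {set n.+1.-bseq 'I_n.+1} :=
  insert_max t.1.2 t.2 |: [set raise l' | l' in t.1.1 :\ t.1.2].

Definition insertions n :
    {set {set n.-bseq 'I_n} * n.-bseq 'I_n * 'I_n.+1} :=
  [set t : {set n.-bseq 'I_n} * n.-bseq 'I_n * 'I_n.+1 |
     [&& t.1.1 \in list_partitions n, t.1.2 \in [bseq] |: t.1.1
       & t.2 <= size t.1.2]].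

Lemma val_insub_bseq (T : Type) n (s : seq T) :
  size s <= n -> insub_bseq n s = s :> seq T.
Proof. by move=> sz; rewrite /insub_bseq insubdK. Qed.

Lemma val_raise n (l : n.-bseq 'I_n) :
  raise l = [seq lift ord_max x | x <- l] :> seq _.
Proof. by rewrite val_insub_bseq // size_map leqW // size_bseq. Qed.

Lemma val_insert_max n (l : n.-bseq 'I_n) i :
  insert_max l i = take i (raise l) ++ ord_max :: drop i (raise l) :> seq _.
Proof.
rewrite val_insub_bseq // size_cat /= addnS -size_cat cat_take_drop.
by rewrite val_raise size_map ltnS size_bseq.
Qed.

Lemma val_remove_max n (l : n.+1.-bseq 'I_n.+1) :
  uniq l -> remove_max l = pmap (unlift ord_max) l :> seq _.
Proof.
move=> ul; rewrite val_insub_bseq //.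
have ul' : uniq (pmap (unlift (@ord_max n)) l).
  by apply: pmap_uniq ul => x; case: unliftP => //= j ->.
by rewrite -(card_uniqP ul') -[leqRHS]card_ord max_card.
Qed.

Lemma mem_raise_lift n (l : n.-bseq 'I_n) x :
  (lift ord_max x \in raise l) = (x \in l).
Proof.
transitivity (lift ord_max x \in (raise l : seq _)); first by [].
by rewrite val_raise (mem_map (@lift_inj _ ord_max)).
Qed.

Lemma mem_raise_max n (l : n.-bseq 'I_n) : (ord_max \in raise l) = false.
Proof.
transitivity (ord_max \in (raise l : seq _)); first by [].
rewrite val_raise; apply/mapP=> -[x _ /eqP].
by rewrite (negbTE (neq_lift _ _)).
Qed.

Lemma mem_insert_max n (l : n.-bseq 'I_n) i x :
  (x \in insert_max l i) = (x == ord_max) || (x \in raise l).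
Proof.
transitivity (x \in (insert_max l i : seq _)); first by [].
by rewrite val_insert_max mem_cat inE orbCA -mem_cat cat_take_drop.
Qed.

Lemma mem_insert_max_max n (l : n.-bseq 'I_n) i : ord_max \in insert_max l i.
Proof. by rewrite mem_insert_max eqxx. Qed.

Lemma mem_insert_max_lift n (l : n.-bseq 'I_n) i x :
  (lift ord_max x \in insert_max l i) = (x \in l).
Proof.
by rewrite mem_insert_max eq_sym (negbTE (neq_lift _ _)) mem_raise_lift.
Qed.

Lemma mem_remove_max n (l : n.+1.-bseq 'I_n.+1) x :
  uniq l -> (x \in remove_max l) = (lift ord_max x \in l).
Proof.
move=> ul; transitivity (x \in (remove_max l : seq _)); first by [].
rewrite val_remove_max // mem_pmap; apply/mapP/idP=> [[y yl]|xl].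
  by case: unliftP => // j eq_y [->]; rewrite -eq_y.
by exists (lift ord_max x); rewrite ?liftK.
Qed.

Lemma uniq_raise n (l : n.-bseq 'I_n) : uniq (raise l) = uniq l.
Proof. by rewrite val_raise (map_inj_uniq (@lift_inj _ _)). Qed.

Lemma uniq_insert_max n (l : n.-bseq 'I_n) i : uniq (insert_max l i) = uniq l.
Proof.
rewrite val_insert_max (perm_uniq (permEl (perm_catCA _ [:: ord_max] _))) /=.
by rewrite cat_take_drop uniq_raise; move: (mem_raise_max l) => /= ->.
Qed.

Lemma raiseK n (l : n.-bseq 'I_n) : remove_max (raise l) = l.
Proof.
apply: val_inj; rewrite /= val_insub_bseq val_raise (map_pK (liftK _)) //.
exact: size_bseq.
Qed.

Lemma insert_maxK n (l : n.-bseq 'I_n) i : remove_max (insert_max l i) = l.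
Proof.
apply: val_inj => /=.
have eq_l : pmap (unlift ord_max) (insert_max l i) = l.
  rewrite val_insert_max pmap_cat /= unlift_none /= -pmap_cat cat_take_drop.
  by rewrite val_raise (map_pK (liftK _)).
by rewrite val_insub_bseq eq_l // size_bseq.
Qed.

Lemma index_insert_max n (l : n.-bseq 'I_n) i :
  i <= size l -> index ord_max (insert_max l i) = i.
Proof.
move=> le_il; rewrite val_insert_max index_cat /= eqxx addn0.
case: ifP => [/mem_take|_]; first by move: (mem_raise_max l) => /= ->.
by rewrite size_takel // val_raise size_map.
Qed.

Lemma remove_maxK n (l : n.+1.-bseq 'I_n.+1) :
  uniq l -> ord_max \notin l -> raise (remove_max l) = l.
Proof.
move=> ul l_max; apply: val_inj; rewrite /= val_raise val_remove_max //.
rewrite (pmap_filter (g := lift ord_max)); last first.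
  by move=> x; case: unliftP => //= j ->.
apply/all_filterP/allP=> x xl; case: unliftP => // eq_x.
by case/negP: l_max; rewrite -eq_x.
Qed.

Lemma remove_insert_maxK n (l : n.+1.-bseq 'I_n.+1) :
  uniq l -> ord_max \in l ->
  insert_max (remove_max l) (index ord_max l) = l.
Proof.
move=> ul l_max; apply: val_inj => /=.
have l_maxs : ord_max \in (l : seq _) by [].
rewrite val_insert_max val_raise val_remove_max //.
rewrite (pmap_filter (g := lift ord_max)); last first.
  by move=> x; case: unliftP => //= j ->.
move: (l : seq _) l_maxs ul => _ /splitPr[l1 l2].
rewrite cat_uniq /= => /and4P[_]; rewrite negb_or => /andP[max_l1 _] max_l2 _.
have someE (s : seq 'I_n.+1) :
    ord_max \notin s -> [seq x <- s | unlift ord_max x] = s.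
  move=> s_max; apply/all_filterP/allP=> x xs; case: unliftP => // eq_x.
  by case/negP: s_max; rewrite -eq_x.
rewrite index_cat (negbTE max_l1) /= eqxx addn0 filter_cat /= unlift_none /=.
by rewrite !someE // take_size_cat // drop_size_cat.
Qed.

Lemma index_max_le n (l : n.+1.-bseq 'I_n.+1) :
  uniq l -> ord_max \in l -> index ord_max l <= size (remove_max l).
Proof.
move=> ul l_max; have := congr1 size (congr1 val (remove_insert_maxK ul l_max)).
rewrite /= val_insert_max size_cat /= addnS -size_cat cat_take_drop val_raise.
by rewrite size_map -ltnS => ->; rewrite index_mem.
Qed.

Lemma add_max_valid n t :
  t \in insertions n -> add_max t \in list_partitions n.+1.
Proof.
case: t => [[p l] i]; rewrite inE /=.
case/and3P=> /list_partitionsP[unip p_nil covp trivp].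
rewrite in_setU1 => l_in _.
have ul : uniq l by case/predU1P: l_in => [->|/unip].
(* A list of [p :\ l] shares no element with [l], even when [l] is empty. *)
have disj l' x : l' \in p :\ l -> x \in l' -> x \in l -> false.
  rewrite in_setD1 => /andP[/eqP ne l'p] xl' xl; case: ne.
  case/predU1P: l_in => [l0|lp]; first by rewrite l0 in xl.
  exact: (trivp _ _ l'p lp x).
have in_add l' : l' \in add_max (p, l, i) ->
    l' = insert_max l i \/ exists2 l1, l1 \in p :\ l & l' = raise l1.
  by case/setU1P=> [->|/imsetP[l1 l1p ->]]; [left | right; exists l1].
apply/list_partitionsP; split.
- move=> l' /in_add[->|[l1 /setD1P[_ l1p] ->]].
    by rewrite uniq_insert_max.
  by rewrite uniq_raise unip.
- apply/negP=> /in_add[|[l1 /setD1P[_ l1p]]] /(congr1 val) /= eq_nil.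
    have: ord_max \in (insert_max l i : seq _) by apply: mem_insert_max_max.
    by rewrite -eq_nil.
  case/negP: p_nil; rewrite (_ : [bseq] = l1) //; apply: val_inj => /=.
  by move: eq_nil; rewrite val_raise; case: (l1 : seq _).
- move=> x; case: (unliftP ord_max x) => [y ->|->]; last first.
    by exists (insert_max l i); rewrite ?setU11 ?mem_insert_max_max.
  have [l' l'p yl'] := covp y; have [eq_l|ne_l] := eqVneq l' l.
    by exists (insert_max l i); rewrite ?setU11 // mem_insert_max_lift -eq_l.
  exists (raise l'); last by rewrite mem_raise_lift.
  by rewrite inE imset_f ?orbT // in_setD1 ne_l.
- move=> l1 l2 /in_add[->|[l1' l1p ->]] /in_add[->|[l2' l2p ->]] x //.
  + case: (unliftP ord_max x) => [y ->|->]; last by rewrite mem_raise_max.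
    rewrite mem_insert_max_lift mem_raise_lift => yl yl2.
    by have := disj _ _ l2p yl2 yl.
  + case: (unliftP ord_max x) => [y ->|->]; last by rewrite mem_raise_max.
    rewrite mem_insert_max_lift mem_raise_lift => yl1 yl.
    by have := disj _ _ l1p yl1 yl.
  + case: (unliftP ord_max x) => [y ->|->]; last by rewrite mem_raise_max.
    case/setD1P: l1p => _ l1p; case/setD1P: l2p => _ l2p.
    by rewrite !mem_raise_lift => yl1 yl2; rewrite (trivp _ _ l1p l2p y).
Qed.

(** The new element is larger than all others, so inserting it into a non-empty
    list does not change the minimum of that list. *)
Lemma leaders_add_max n t : t \in insertions n ->
  leaders (add_max t) =
    (if t.1.2 == [bseq] then [set ord_max] else set0)
      :|: lift ord_max @: leaders t.1.1.
Proof.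
case: t => [[p l] i] /[dup] ins_t; rewrite inE /= => /and3P[ok_p l_in _].
have [unip p_nil covp trivp] := list_partitionsP _ ok_p.
have lift_le (x y : 'I_n) : (lift ord_max x <= lift ord_max y) = (x <= y).
  by rewrite !lift_max.
apply/setP=> x; rewrite in_setU; case: (unliftP ord_max x) => [y|] ->.
- rewrite (mem_imset _ _ (@lift_inj _ _)).
  have -> : lift ord_max y \in
      (if l == [bseq] then [set ord_max] else set0) = false.
    by case: ifP => _; rewrite inE // eq_sym (negbTE (neq_lift _ _)).
  apply/leadersP/leadersP => [[l' []]|].
    case/setU1P=> [->|/imsetP[l1 /setD1P[_ l1p] ->]].
  + rewrite mem_insert_max_lift => yl min_y; exists l; split=> //.
      by case/setU1P: l_in => // l0; rewrite l0 in yl.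
    move=> j jl; rewrite -lift_le min_y //.
    by rewrite mem_insert_max_lift.
  + rewrite mem_raise_lift => yl min_y; exists l1; split=> // j jl.
    by rewrite -lift_le min_y // mem_raise_lift.
  + case=> l' [l'p yl' min_y]; have [eq_l|ne_l] := eqVneq l' l; last first.
      exists (raise l'); split; rewrite ?mem_raise_lift //.
        by rewrite inE imset_f ?orbT // in_setD1 ne_l.
      move=> j; case: (unliftP ord_max j) => [k|] ->; last first.
        by rewrite mem_raise_max.
      by rewrite mem_raise_lift lift_le; apply: min_y.
    exists (insert_max l i); split; first exact: setU11.
      by rewrite mem_insert_max_lift -eq_l.
    move=> j; case: (unliftP ord_max j) => [k|] ->.
      by rewrite mem_insert_max_lift lift_le -eq_l; apply: min_y.
    by move=> _; rewrite -ltnS ltn_ord.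
- have -> : ord_max \in lift ord_max @: leaders p = false.
    by apply/imsetP=> -[y _ /eqP]; rewrite (negbTE (neq_lift _ _)).
  rewrite orbF; have [l0|/bseq_has_mem[y yl]] := eqVneq l [bseq].
    rewrite set11; apply/leadersP; exists (insert_max l i); split.
    + exact: setU11.
    + exact: mem_insert_max_max.
    move=> j; case: (unliftP ord_max j) => [k|] -> //.
    by rewrite mem_insert_max_lift l0.
  rewrite in_set0; apply/negbTE/leadersP=> -[l' []].
  case/setU1P=> [->|/imsetP[l1 _ ->]]; last first.
    by rewrite mem_raise_max.
  move=> _ /(_ (lift ord_max y)); rewrite mem_insert_max_lift yl.
  by rewrite lift_max leqNgt ltn_ord => /(_ isT).
Qed.

(** The list holding the new element gives back [l] and [i]. Erasing the new
    element everywhere gives back [p], up to an empty list to be discarded when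
    the new element stood alone. *)
Lemma add_max_inj n : {in insertions n &, injective (@add_max n)}.
Proof.
move=> [[p1 l1] i1] [[p2 l2] i2].
rewrite inE [in X in _ -> X -> _]inE /=.
case/and3P=> /list_partitionsP[_ p1_nil _ _] l1_in le_i1.
case/and3P=> /list_partitionsP[_ p2_nil _ _] l2_in le_i2 eq_add.
have eq_ins : insert_max l1 i1 = insert_max l2 i2.
  have: insert_max l1 i1 \in add_max (p2, l2, i2) by rewrite -eq_add setU11.
  case/setU1P=> // /imsetP[l _ /= eq_l].
  by have := mem_insert_max_max l1 i1; rewrite eq_l mem_raise_max.
have eq_l : l1 = l2 by rewrite -(insert_maxK l1 i1) eq_ins insert_maxK.
have eq_i : i1 = i2.
  apply: val_inj.
  by rewrite /= -(index_insert_max le_i1) eq_ins index_insert_max.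
suff eq_p : p1 = p2 by rewrite eq_p eq_l eq_i.
suff removeK (p : {set n.-bseq 'I_n}) (l : n.-bseq 'I_n) (i : 'I_n.+1) :
    [bseq] \notin p -> l \in [bseq] |: p ->
    (@remove_max n @: add_max (p, l, i)) :\ [bseq] = p.
  by rewrite -(removeK p1 l1 i1) // eq_add removeK.
move=> p_nil l_in; rewrite imsetU1 insert_maxK -imset_comp.
rewrite (eq_imset (g := id)) ?imset_id; last by move=> l'; rewrite /= raiseK.
have pD : p :\ [bseq] = p by apply/setDidPl; rewrite disjoint_sym disjoints1.
have [l0|l_ne] := eqVneq l [bseq].
  by rewrite l0 setU1K pD.
have lp : l \in p by move: l_in; rewrite in_setU1 (negbTE l_ne).
by rewrite setD1K // pD.
Qed.

(** Given a list partition with new element [ord_max] in the list [lm], the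
    triple to insert back consists of what remains after erasing [ord_max], of
    the remainder of [lm], and of the position of [ord_max] in [lm]. *)
Lemma add_max_imset n : @add_max n @: insertions n = list_partitions n.+1.
Proof.
apply/setP=> p; apply/imsetP/idP=> [[t ins_t ->]|]; first exact: add_max_valid.
case/list_partitionsP=> unip p_nil covp trivp.
have [lm lm_p lm_max] := covp ord_max.
have no_max l : l \in p :\ lm -> ord_max \notin l.
  case/setD1P=> ne_l lp; apply: contraNN ne_l => l_max; apply/eqP.
  exact: (trivp _ _ lp lm_p ord_max).
have raiseD l : l \in p :\ lm -> raise (remove_max l) = l.
  by move=> lp; rewrite remove_maxK ?no_max // unip; case/setD1P: lp.
have remove_ne l : l \in p :\ lm ->
    remove_max l != [bseq] /\ remove_max l != remove_max lm.
  move=> l_in; have [/eqP ne_l lp] := setD1P l_in.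
  have [x xl] : exists x, x \in remove_max l.
    have [x xl] : exists x, x \in l.
      by apply: bseq_has_mem; apply: contraNneq p_nil => <-.
    case: (unliftP ord_max x) xl (no_max _ l_in) => [y|] -> xl; last first.
      by rewrite xl.
    by exists y; rewrite mem_remove_max // unip.
  split; first by apply/eqP=> l0; rewrite l0 in xl.
  apply/eqP=> eq_l; case: ne_l; apply: (trivp _ _ lp lm_p (lift ord_max x)).
    by rewrite -mem_remove_max // unip.
  by rewrite -mem_remove_max -?eq_l // unip.
pose q := [set remove_max l | l in p] :\ [bseq].
have lm_q : remove_max lm \in [bseq] |: q.
  by rewrite !inE imset_f // andbT orbN.
have qE : q :\ remove_max lm = [set remove_max l | l in p :\ lm].
  apply/setP=> l; rewrite in_setD1 [l \in q]in_setD1.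
  apply/and3P/imsetP=> [[ne_l _ /imsetP[l1 l1p eq_l]]|[l1 l1_in ->]].
    exists l1 => //; rewrite in_setD1 l1p andbT.
    by apply: contraNneq ne_l => <-; rewrite eq_l.
  have [? ?] := remove_ne _ l1_in; have [_ l1p] := setD1P l1_in.
  by split=> //; apply: imset_f.
have lt_i : index ord_max lm < n.+1.
  by rewrite ltnS (leq_trans (index_max_le (unip _ lm_p) lm_max)) // size_bseq.
exists (q, remove_max lm, Ordinal lt_i); last first.
  rewrite /add_max /= remove_insert_maxK ?unip // qE -imset_comp.
  by rewrite (eq_in_imset (g := id)) ?imset_id ?setD1K.
rewrite inE /= lm_q index_max_le ?unip //= andbT.
apply/list_partitionsP; split.
- move=> _ /setD1P[_ /imsetP[l lp ->]]; rewrite val_remove_max ?unip //.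
  by apply: pmap_uniq (unip _ lp) => x; case: unliftP => //= j ->.
- by rewrite in_setD1 eqxx.
- move=> x; have [l lp xl] := covp (lift ord_max x).
  have xl' : x \in remove_max l by rewrite mem_remove_max ?unip.
  exists (remove_max l) => //; rewrite in_setD1 imset_f // andbT.
  by apply/eqP=> l0; rewrite l0 in xl'.
- move=> _ _ /setD1P[_ /imsetP[l1 l1p ->]] /setD1P[_ /imsetP[l2 l2p ->]] x.
  rewrite !mem_remove_max ?unip // => xl1 xl2.
  by rewrite (trivp _ _ l1p l2p (lift ord_max x)).
Qed.

(** * Counting by sets of leaders *)

Definition leader_count n (B : {set 'I_n}) : nat :=
  #|[set p in list_partitions n | leaders p == B]|.

(** The factor [(size l).+1] counts the positions at which the new element can
    be inserted into [l]. *)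
Lemma leader_countS n (B : {set 'I_n.+1}) :
  leader_count B =
    \sum_(p in list_partitions n)
      \sum_(l in [bseq] |: p |
            (if l == [bseq] then [set ord_max] else set0)
              :|: lift ord_max @: leaders p == B)
        (size l).+1.
Proof.
pose S := [set t in insertions n | leaders (add_max t) == B].
have -> : leader_count B = #|S|.
  rewrite -(card_in_imset (f := @add_max n) (D := S)); last first.
    by move=> t1 t2 /setIdP[t1S _] /setIdP[t2S _]; apply: add_max_inj.
  congr #|pred_of_set _|; apply/setP=> p; rewrite inE -add_max_imset.
  apply/andP/imsetP=> [[/imsetP[t t_in ->] tB]|[t /setIdP[t_in tB] ->]].
    by exists t => //; rewrite inE t_in.
  by rewrite imset_f.
rewrite -sum1_card; under [RHS]eq_bigr => p _.
  under eq_bigr => l _.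
    rewrite -[(size l).+1]card_ord -sum1_card.
    rewrite (big_ord_widen n.+1 (fun=> 1)) ?ltnS ?size_bseq //.
    over.
  over.
rewrite pair_big_dep /= pair_big_dep /=; apply: eq_bigl => t.
transitivity ((t \in insertions n) &&
    ((if t.1.2 == [bseq] then [set ord_max] else set0)
       :|: lift ord_max @: leaders t.1.1 == B)).
  by rewrite inE; apply: andb_id2l => /leaders_add_max ->.
by rewrite inE -!andbA; congr [&& _, _ & _]; apply: andbC.
Qed.

Lemma imset_lift_inj n : injective (fun B : {set 'I_n} => lift ord_max @: B).
Proof. exact/imset_inj/lift_inj. Qed.

Lemma max_notin_imset_lift n (B : {set 'I_n}) :
  ord_max \notin lift ord_max @: B.
Proof.
by apply/imsetP=> -[y _ /eqP]; rewrite (negbTE (neq_lift _ _)).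
Qed.

(** If the largest element is a leader, then it forms a list by itself, so it
    can be added in a single way. *)
Lemma leader_count_max n (B : {set 'I_n}) :
  leader_count (ord_max |: lift ord_max @: B) = leader_count B.
Proof.
rewrite leader_countS /leader_count -sum1dep_card [RHS]big_mkcondr /=.
apply: eq_bigr => p p_ok; rewrite big_mkcondr /=.
have [_ p_nil _ _] := list_partitionsP _ p_ok.
rewrite big_setU1 //= [X in _ + X]big1 ?addn0 => [|l lp].
  rewrite -(inj_eq (@imset_lift_inj n)); congr (if _ then _ else _).
  apply/eqP/eqP=> [/(congr1 (fun C => C :\ ord_max))|-> //].
  by rewrite !setU1K ?max_notin_imset_lift.
rewrite ifN // ifN; last by apply: contraNneq p_nil => <-.
rewrite set0U; apply: contraTneq isT => eqB.
by have := max_notin_imset_lift (leaders p); rewrite eqB setU11.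
Qed.

(** Otherwise the largest element follows one of the [n] smaller elements or
    comes first in one of the [#|B|] lists. *)
Lemma leader_count_nomax n (B : {set 'I_n}) :
  leader_count (lift ord_max @: B) = (n + #|B|) * leader_count B.
Proof.
rewrite leader_countS /leader_count -sum1dep_card big_distrr /=.
rewrite [RHS]big_mkcondr /=.
apply: eq_bigr => p p_ok; rewrite big_mkcondr /=.
have [_ p_nil _ _] := list_partitionsP _ p_ok.
rewrite big_setU1 //= ifN ?add0n; last first.
  apply: contraTneq isT => eqB.
  by have := max_notin_imset_lift B; rewrite -eqB setU11.
have ne_nil l : l \in p -> (l == [bseq]) = false.
  by move=> lp; apply/negbTE; apply: contraNneq p_nil => <-.
under eq_bigr => l /ne_nil -> do rewrite set0U (inj_eq (@imset_lift_inj n)).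
case: eqP => [<-|_]; last by rewrite big1.
under eq_bigr do rewrite -addn1.
by rewrite big_split /= sum_size_lists // sum1_card card_leaders // muln1.
Qed.

(** A tuple of list partitions with common leader set [B] is an arbitrary word
    over the list partitions with that leader set. For [s = 0] this fails: the
    empty tuple is counted once, whatever [k] is. *)
Lemma lah_leader_count s n k : 0 < s ->
  lah s n k = \sum_(B : {set 'I_n} | #|B| == k) leader_count B ^ s.
Proof.
case: s => // s _; rewrite /lah -sum1_card.
pose lead (t : s.+1.-tuple {set n.-bseq 'I_n}) := leaders (tnth t ord0).
rewrite (partition_big lead (fun B => #|B| == k)) /lead /=; last first.
  move=> t; rewrite inE => /andP[/forallP/(_ ord0) ok _].
  have card_t : #|tnth t ord0| = k by case/and4P: ok => /eqP.
  by rewrite card_leaders ?card_t // inE card_t.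
apply: eq_bigr => B /eqP cardB; rewrite sum1dep_card.
rewrite -[X in _ ^ X]card_ord -card_ffun_on.
pose f (t : s.+1.-tuple {set n.-bseq 'I_n}) := [ffun i => tnth t i].
have f_inj : injective f.
  move=> t1 t2 /ffunP eq_f; apply: eq_from_tnth => i.
  by have := eq_f i; rewrite !ffunE.
rewrite -(card_imset _ f_inj); apply: eq_card => g.
apply/imsetP/ffun_onP=> [[t] | g_in].
  rewrite !inE => /andP[/andP[/forallP ok /forallP eq_lead] /eqP tB] -> i.
  rewrite ffunE !inE; have := ok i; rewrite -tB.
  have -> : leaders (tnth t i) == leaders (tnth t ord0).
    exact: (forallP (eq_lead i)).
  by rewrite andbT => /[dup] /and4P[/eqP -> _ _ _].
have leadg i : leaders (g i) = B by have /setIdP[_ /eqP] := g_in i.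
exists [tuple g i | i < s.+1]; last first.
  by apply/ffunP=> i; rewrite ffunE tnth_mktuple.
rewrite !inE tnth_mktuple leadg eqxx andbT.
apply/andP; split; apply/forallP=> i.
  have /setIdP[ok_gi _] := g_in i; have := card_leaders ok_gi.
  by rewrite tnth_mktuple leadg cardB => ->; move: ok_gi; rewrite inE.
by apply/forallP=> j; rewrite !tnth_mktuple !leadg.
Qed.

Lemma big_set_max n (F : {set 'I_n.+1} -> nat) :
  \sum_B F B =
    \sum_(B : {set 'I_n}) F (ord_max |: lift ord_max @: B)
      + \sum_(B : {set 'I_n}) F (lift ord_max @: B).
Proof.
have nomax (B : {set 'I_n.+1}) :
    ord_max \notin B -> lift ord_max @: (lift ord_max @^-1: B) = B.
  move=> B_max; apply/setP=> x; apply/imsetP/idP=> [[y]|xB].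
    by rewrite inE => yB ->.
  case: (unliftP ord_max x) xB => [y|] -> xB; last by rewrite xB in B_max.
  by exists y; rewrite // inE.
have liftK (B : {set 'I_n}) :
    lift ord_max @^-1: (ord_max |: lift ord_max @: B) = B
      /\ lift ord_max @^-1: (lift ord_max @: B) = B.
  by split; apply/setP=> x; rewrite !inE ?(mem_imset _ _ (@lift_inj _ _)) //
    eq_sym (negbTE (neq_lift _ _)).
rewrite (bigID (fun B : {set 'I_n.+1} => ord_max \in B)) /=; congr (_ + _).
  rewrite (reindex_onto (fun B : {set 'I_n} => ord_max |: lift ord_max @: B)
             (fun B : {set 'I_n.+1} => lift ord_max @^-1: B)) /=.
    apply: eq_bigl => B.
    by rewrite setU11; have [-> _] := liftK B; rewrite eqxx.
  move=> B B_max.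
  have -> : lift ord_max @^-1: B = lift ord_max @^-1: (B :\ ord_max).
    by apply/setP=> x; rewrite !inE eq_sym (negbTE (neq_lift _ _)).
  by rewrite nomax ?setD1K // in_setD1 eqxx.
rewrite (reindex_onto (fun B : {set 'I_n} => lift ord_max @: B)
           (fun B : {set 'I_n.+1} => lift ord_max @^-1: B)) /=; last first.
  exact: nomax.
apply: eq_bigl => B; rewrite max_notin_imset_lift.
by have [_ ->] := liftK B; rewrite eqxx.
Qed.

Lemma lahS s n k : 0 < s ->
  lah s n.+1 k =
    (if k is k'.+1 then lah s n k' else 0) + (n + k) ^ s * lah s n k.
Proof.
move=> s_gt0; rewrite !lah_leader_count // big_mkcond big_set_max /=.
have cardL (B : {set 'I_n}) : #|lift ord_max @: B| = #|B|.
  by rewrite card_imset //; apply: lift_inj.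
congr (_ + _).
  under eq_bigr do rewrite cardsU1 max_notin_imset_lift cardL leader_count_max.
  case: k => [|k]; first by rewrite big1.
  by rewrite lah_leader_count // [RHS]big_mkcond.
rewrite big_distrr [RHS]big_mkcond /=; apply: eq_bigr => B _.
by rewrite cardL leader_count_nomax; case: eqP => // <-; rewrite expnMn.
Qed.

Lemma lah_gt s n k : 0 < s -> n < k -> lah s n k = 0.
Proof.
move=> s_gt0 lt_nk; rewrite lah_leader_count // big1 // => B /eqP cardB.
by move: (max_card B); rewrite cardB card_ord leqNgt lt_nk.
Qed.

(** * The recurrence for the polynomials *)

Local Open Scope ring_scope.

Theorem theorem2p5 (n s : nat) (hn : (1 <= n)%N) (hs : (1 <= s)%N) :
  Q_poly s n.+1 = 'X^2 * Q_poly s n + 'X * A_poly s n.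
Proof.
have L_recE : L_poly s n.+1 =
    'X * L_poly s n + \sum_(k < n.+1) ((n + k) ^ s * lah s n k)%:R *: 'X^k.
  rewrite /L_poly; under eq_bigr do rewrite lahS // natrD scalerDl.
  rewrite big_split /=.
  (* The two sums over [k < n.+2] lose their first, resp. last, term. *)
  rewrite big_ord_recl /= scale0r add0r; congr (_ + _).
    by rewrite big_distrr; apply: eq_bigr => k _; rewrite /= -scalerAr -exprS.
  by rewrite big_ord_recr /= (lah_gt hs (ltnSn n)) muln0 scale0r addr0.
rewrite /Q_poly L_recE mulrDr; congr (_ + _).
  by rewrite !mulrA -exprSr -exprD.
rewrite exprS -mulrA; congr (_ * _).
rewrite /A_poly big_distrr; apply: eq_bigr => k _.
by rewrite /= -scalerAr exprD.
Qed.
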